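(* Let $1<p_1,p_2<\infty$ be such that $\frac1{p_1}+\frac1{p_2}=1$, and set $h(s,t)=\chi_{\ge0}(s-t)$ for $s,t\in\mathbb{R}$. There exists an absolute constant $C>0$ (independent of $N$, $p_1$, $p_2$) such that for every integer $N\ge1$ we have $$\|T_h^{(N)}:L_{p_1}(\mathbb{R},S_{p_1}^N)\times L_{p_2}(\mathbb{R},S_{p_2}^N)\to L_1(\mathbb{R},S_1^N)\|>C\log(N).$$
   Context: $\chi_{\ge0}$ is the indicator function of $[0,\infty)$. $S_q^N=S_q(\mathbb{C}^N)$ is the space of $N\times N$ complex matrices with the Schatten $q$-norm $\mathrm{Tr}(|x|^q)^{1/q}$, and $L_q(\mathbb{R},S_q^N)$ is the Bochner $L_q$-space with respect to Lebesgue measure. The bilinear map $T_h^{(N)}$ is determined by $$T_h^{(N)}(f_1,f_2)(s)=\int_{\mathbb{R}}\int_{\mathbb{R}}\widehat{f_1}(\xi_1)\widehat{f_2}(\xi_2)\,h(\xi_1,\xi_2)\,e^{is(\xi_1+\xi_2)}\,d\xi_1d\xi_2,\qquad s\in\mathbb{R},$$ where $f_i\in L_{p_i}(\mathbb{R},S_{p_i}^N)$ have Fourier transforms $\widehat{f_i}:\mathbb{R}\to S_{p_i}^N$ that are continuous and compactly supported; the product $\widehat{f_1}(\xi_1)\widehat{f_2}(\xi_2)$ is the matrix product, and the Fourier transform is normalised so that $f(s)=\int_{\mathbb{R}}\widehat f(\xi)e^{is\xi}\,d\xi$. The norm in the claim is the bilinear operator norm, i.e. the supremum of $\|T_h^{(N)}(f_1,f_2)\|_{L_1(\mathbb{R},S_1^N)}$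 over such $f_i$ with $\|f_i\|_{L_{p_i}(\mathbb{R},S_{p_i}^N)}\le1$. (For each fixed $N$ the map is known to be bounded.) *)

(* Defs.v *)
From HB Require Import structures.
From mathcomp Require Import all_boot all_order all_algebra.
From mathcomp Require Import complex.
From mathcomp Require Import all_classical all_reals all_analysis.

Set Implicit Arguments.
Unset Strict Implicit.
Unset Printing Implicit Defensive.

Import Order.TTheory GRing.Theory Num.Theory.
Import numFieldNormedType.Exports.

Local Open Scope classical_set_scope.
Local Open Scope sesquilinear_scope.
Local Open Scope complex_scope.
Local Open Scope ring_scope.

Section Schatten.
Context {R : realType} {N : nat}.
Implicit Types (A : 'M[R[i]]_N) (q : R).

(* Functional calculus; meaningful for normal [A], where
   [A = invmx P *m diag_mx (spectral_diag A) *m P] with [P] unitary. *)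
Definition mxfun (phi : R[i] -> R[i]) A : 'M[R[i]]_N :=
  invmx (spectralmx A) *m diag_mx (map_mx phi (spectral_diag A))
    *m spectralmx A.

Definition mxabs A : 'M[R[i]]_N := mxfun sqrtC (A^t* *m A).

(* Real power of a positive semidefinite matrix. *)
Definition mxpowR A q : 'M[R[i]]_N := mxfun (fun z => (complex.Re z `^ q)%:C) A.

(* The trace is a nonnegative real; [complex.Re] is only a cast to [R]. *)
Definition schatten_norm q A : R :=
  complex.Re (\tr (mxpowR (mxabs A) q)) `^ q^-1.

End Schatten.

Section MatrixValuedFunctions.
Context {R : realType} {N : nat}.
Implicit Types (f g : R -> 'M[R[i]]_N) (q : R).

Notation mu := (@lebesgue_measure R).

Definition mx_measurable f : Prop :=
  forall i j, measurable_fun setT (fun s => complex.Re (f s i j)) /\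
              measurable_fun setT (fun s => complex.Im (f s i j)).

(* The Bochner integral: the target is finite-dimensional, so it is computed
   on the real and imaginary parts of the entries. *)
Definition mx_integral f : 'M[R[i]]_N :=
  \matrix_(i, j) ((\int[mu]_x complex.Re (f x i j))
                  +i* (\int[mu]_x complex.Im (f x i j))).

Definition bochner_norm q f : \bar R :=
  Lnorm mu q%:E (fun s => (schatten_norm q (f s))%:E).

Definition in_bochner_Lp q f : Prop :=
  mx_measurable f /\ (bochner_norm q f < +oo)%E.

Definition expi (t : R) : R[i] := cos t +i* sin t.

Definition inv_fourier g (s : R) : 'M[R[i]]_N :=
  mx_integral (fun xi => expi (s * xi) *: g xi).

(* [f] has a continuous, compactly supported Fourier transform, namely [g].
   This is stated through the inversion formula since [f] need not be
   integrable. The alias [R[i]^o] carries the topology of the complex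
   modulus. *)
Definition has_fourier_Cc f g : Prop :=
  [/\ continuous (g : R -> 'M[R[i]^o]_N),
      compact (closure [set xi | g xi != 0]) &
      {ae mu, forall s, f s = inv_fourier g s}].

End MatrixValuedFunctions.

Section BilinearMultiplier.
Context {R : realType}.
Variable h : R -> R -> R[i].

(* [T_h(f1, f2)], as a function of the Fourier transforms [g1] of [f1] and
   [g2] of [f2]. *)
Definition bilinear_multiplier (N : nat) (g1 g2 : R -> 'M[R[i]]_N) (s : R) :
    'M[R[i]]_N :=
  mx_integral (fun xi2 => mx_integral (fun xi1 =>
    (h xi1 xi2 * expi (s * (xi1 + xi2))) *: (g1 xi1 *m g2 xi2))).

Definition multiplier_norm (N : nat) (p1 p2 p : R) : \bar R :=
  ereal_sup [set r | exists f1 f2 g1 g2 : R -> 'M[R[i]]_N,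
    [/\ in_bochner_Lp p1 f1 /\ in_bochner_Lp p2 f2,
        has_fourier_Cc f1 g1 /\ has_fourier_Cc f2 g2,
        (bochner_norm p1 f1 <= 1)%E /\ (bochner_norm p2 f2 <= 1)%E &
        r = bochner_norm p (bilinear_multiplier g1 g2)]].

End BilinearMultiplier.

Definition chi_ge0 {R : realType} (x : R) : R := \1_(`[0, +oo[%classic : set R) x.

(* Main.v *)
Require Import Defs.
From mathcomp Require Import all_boot all_order all_algebra.
From mathcomp Require Import complex.
From mathcomp Require Import all_classical all_reals all_analysis.
From mathcomp Require Import measurable_realfun ring lra.
Import Order.TTheory GRing.Theory Num.Theory.
Import numFieldNormedType.Exports.
Local Open Scope complex_scope.
Local Open Scope ring_scope.

(** Take [phi s = 2 (1 - cos s) / s ^ 2], whose Fourier transform is the tent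
    [max 0 (1 - |x|)], and the rank one functions
    [f1 s = k1 phi(s) / N * (e^{is a_j})_{jk}] and
    [f2 s = k2 phi(s) / N * (e^{is d_l})_{kl}], with Schatten norms [k1 phi]
    and [k2 phi] for every exponent. With the frequencies [a_j = 8 j + 4] and
    [d_l = 8 l] the supports of the shifted tents are separated and [h] is [1]
    on them if [l <= j] and [0] otherwise, so that [T_h (f1, f2) (s)] is
    [k1 k2 phi(s)^2] times, up to diagonal unitary factors on both sides, the
    triangular matrix [([l <= j] / N)_{jl}]. Testing the latter on the discrete Fourier
    basis, the diagonal entries are [1 / (N (1 - w^k))] for [k > 0], of modulus
    at least [1 / (2 pi k)]; their sum bounds the trace norm from below and is
    of order [log N]. *)

(** * Schatten norms *)

Section SchattenNorm.
Local Open Scope sesquilinear_scope.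
Context {R : realType} {N : nat}.
Implicit Types (A B E F : 'M[R[i]]_N) (phi : R[i] -> R[i]).

Lemma mxtrace_mxfun phi B :
  \tr (mxfun phi B) = \sum_i phi (spectral_diag B 0 i).
Proof.
rewrite /mxfun mxtrace_mulC mulmxA mulmxV ?spectral_unit// mul1mx mxtrace_diag.
by apply: eq_bigr => i _; rewrite mxE.
Qed.

Lemma normalmx_gram A : A^t* *m A \is normalmx.
Proof.
by apply/normalmxP; rewrite trmx_mul map_mxM trmxCK.
Qed.

Lemma diag_spectral B : B \is normalmx ->
  diag_mx (spectral_diag B) = spectralmx B *m B *m (spectralmx B)^t*.
Proof.
move=> /orthomx_spectralP BE; rewrite [in X in _ = _ *m X *m _]BE.
rewrite -invmx_unitary ?spectral_unitarymx//.
by rewrite !mulmxA mulmxV ?mul1mx ?mulmxK ?spectral_unit.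
Qed.

(** Conjugation by the eigenbasis turns the Gram matrix into that of [A] written in this basis, so
    its eigenvalues are squared column norms; a unitary [E] on the left preserves these. *)
Lemma spectral_diag_gram A E i : E \is unitarymx ->
  spectral_diag (A^t* *m A) 0 i =
  \sum_k `|(E *m A *m (spectralmx (A^t* *m A))^t*) k i| ^+ 2.
Proof.
move=> Eu; have /matrixP/(_ i i) := diag_spectral _ (normalmx_gram A).
rewrite mxE eqxx mulr1n => ->.
set P := spectralmx _; set X := E *m A *m _.
have -> : P *m (A^t* *m A) *m P^t* = X^t* *m X.
  rewrite /X !trmx_mul !map_mxM trmxCK !mulmxA.
  rewrite -[_ *m E^t* *m E]mulmxA.
  have /unitarymxP := Eu; rewrite -trmxC_unitary in Eu.
  by move/unitarymxP: Eu; rewrite trmxCK => -> _; rewrite mulmx1.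
rewrite mxE; apply: eq_bigr => k _.
by rewrite !mxE mulrC normCK.
Qed.

Lemma spectral_diag_gram_ge0 A i : 0 <= spectral_diag (A^t* *m A) 0 i.
Proof.
have u1 : 1%:M \is (@unitarymx R[i] N N).
  by apply/unitarymxP; rewrite trmx1 map_mx1 mulmx1.
rewrite (spectral_diag_gram A _ i u1); apply: sumr_ge0 => k _.
exact/exprn_ge0/normr_ge0.
Qed.

(** [B] is the fourth root of the spectrum of [A^t* *m A], applied after the change of basis. In
    Gram form, [mxabs A] inherits the nonnegativity of [spectral_diag_gram_ge0]. *)
Lemma mxabs_gram A : exists B, mxabs A = B^t* *m B.
Proof.
rewrite /mxabs /mxfun; set P := spectralmx _; set d := spectral_diag _.
exists (diag_mx (map_mx (sqrtC \o sqrtC) d) *m P).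
rewrite trmx_mul map_mxM tr_diag_mx map_diag_mx -invmx_unitary ?spectral_unitarymx//.
rewrite -!mulmxA; congr (_ *m _); rewrite !mulmxA; congr (_ *m _).
rewrite mulmx_diag; congr diag_mx; apply/rowP => i; rewrite !mxE /=.
have s0 : 0 <= sqrtC (sqrtC (d 0 i)) by rewrite !sqrtC_ge0 spectral_diag_gram_ge0.
by rewrite (CrealP _) ?ger0_real// -expr2 sqrtCK.
Qed.

Lemma schatten_norm1 A : (schatten_norm 1 A)%:C = \tr (mxabs A).
Proof.
have trE : \tr (mxpowR (mxabs A) 1) = \tr (mxabs A).
  have [B ->] := mxabs_gram A.
  rewrite /mxpowR mxtrace_mxfun.
  have /orthomx_spectralP {2}-> := normalmx_gram B.
  rewrite mxtrace_mulC mulmxA mulmxV ?spectral_unit// mul1mx mxtrace_diag.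
  apply: eq_bigr => i _; have d0 := spectral_diag_gram_ge0 B i.
  by rewrite powRr1 ?RRe_real ?ger0_real// -lecR RRe_real ?ger0_real.
have tr0 : 0 <= \tr (mxabs A).
  rewrite mxtrace_mxfun; apply: sumr_ge0 => i _.
  by rewrite sqrtC_ge0 spectral_diag_gram_ge0.
rewrite /schatten_norm trE invr1 powRr1; last by rewrite -lecR RRe_real ?(ger0_real tr0).
exact: RRe_real (ger0_real tr0).
Qed.

(** Insert [P^t* *m P] between [A] and [F], where [P] diagonalises [A^t* *m A], and apply
    Cauchy-Schwarz for each intermediate index [i]: column [i] of [E *m A *m P^t*] has norm the
    [i]-th singular value, and row [i] of [P *m F] has norm one. *)
Lemma sum_norm_diag_le_schatten_norm1 A E F :
  E \is unitarymx -> F \is unitarymx ->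
  \sum_k `|(E *m A *m F) k k| <= (schatten_norm 1 A)%:C.
Proof.
move=> Eu Fu; rewrite schatten_norm1 mxtrace_mxfun.
pose P := spectralmx (A^t* *m A).
have Pu : P \is unitarymx by exact: spectral_unitarymx.
pose X := E *m A *m P^t*; pose Y := P *m F.
have Yu : Y \is unitarymx by exact: (mul_unitarymx Pu Fu).
have -> : E *m A *m F = X *m Y.
  by rewrite /X /Y mulmxA mulmxKtV.
apply: (@le_trans _ _ (\sum_k \sum_i `|X k i| * `|Y i k|)).
  apply: ler_sum => k _; rewrite mxE; apply: le_trans (ler_norm_sum _ _ _) _.
  by apply: ler_sum => i _; rewrite normrM.
rewrite exchange_big /=; apply: ler_sum => i _.
pose u := \row_k `|X k i|; pose v := \row_k `|Y i k|.
have uv : \sum_k `|X k i| * `|Y i k| = dotmx u v.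
  rewrite dotmxE mxE; apply: eq_bigr => k _; rewrite !mxE.
  by rewrite (CrealP _) ?normr_real.
have uu : dotmx u u = spectral_diag (A^t* *m A) 0 i.
  rewrite (spectral_diag_gram A E i Eu) dotmxE mxE; apply: eq_bigr => k _.
  by rewrite !mxE (CrealP _) ?normr_real// -expr2.
have vv : dotmx v v = 1.
  have /unitarymxP/matrixP/(_ i i) := Yu; rewrite !mxE eqxx => YY.
  apply: etrans YY; rewrite dotmxE mxE; apply: eq_bigr => k _.
  by rewrite !mxE (CrealP _) ?normr_real// -expr2 normCK.
have [CS _] := CauchySchwarz_sqrt (@dotmx _ N) u v.
have {CS} : `|dotmx u v| <= sqrtC (dotmx u u) * sqrtC (dotmx v v) := CS.
rewrite uu vv sqrtC1 mulr1 -uv.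
apply: le_trans; rewrite real_ler_norm//.
by apply: ger0_real; apply: sumr_ge0 => k _; rewrite mulr_ge0.
Qed.

(* The hypothesis [B *m B = c *: B] forces the spectrum into [{0, c}], where
   [phi] is multiplication by [k]. *)
Lemma mxfun_quasi_idempotent phi B c k : B \is normalmx -> B *m B = c *: B ->
  phi 0 = 0 -> phi c = k * c -> mxfun phi B = k *: B.
Proof.
move=> Bn BB phi0 phic.
have /orthomx_spectralP {2}-> := Bn.
rewrite /mxfun scalemxAl scalemxAr; congr (_ *m _ *m _).
have DD : diag_mx (spectral_diag B) *m diag_mx (spectral_diag B) =
    c *: diag_mx (spectral_diag B).
  rewrite diag_spectral// !mulmxA mulmxKtV ?spectral_unitarymx//.
  by rewrite -(mulmxA _ B B) BB -scalemxAr -scalemxAl.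
rewrite -linearZ /=; congr diag_mx; apply/rowP => i; rewrite !mxE.
have /matrixP/(_ i i) := DD.
rewrite mulmx_diag !mxE eqxx !mulr1n => /eqP.
rewrite -subr_eq0 -mulrBl mulf_eq0 subr_eq0 => /orP[/eqP->//|/eqP->].
by rewrite phi0 mulr0.
Qed.

(** [Q] is an orthogonal projection of rank one, so [mxabs A] is [r Q] and its [q]-th power [r^q Q]
    has trace [r^q]. This gives the test functions the same pointwise norm for every exponent. *)
Lemma schatten_norm_rank1 A Q (r q : R) : q != 0 -> 0 <= r ->
  Q *m Q = Q -> Q^t* = Q -> \tr Q = 1 -> A^t* *m A = (r ^+ 2)%:C *: Q ->
  schatten_norm q A = r.
Proof.
move=> q0 r0 QQ Qh trQ AA.
have Zn (z : R) : z%:C *: Q \is normalmx.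
  by apply/normalmxP; rewrite linearZ /= map_mxZ Qh /= (CrealP _) ?complex_real.
have ZZ (z : R) : (z%:C *: Q) *m (z%:C *: Q) = z%:C *: (z%:C *: Q).
  by rewrite -scalemxAl -scalemxAr QQ.
(* On the eigenvalue [r ^ 2] the square root is multiplication by [r^-1]; the case [r = 0] is
   consistent because [0^-1 = 0]. *)
have absE : mxabs A = r%:C *: Q.
  rewrite /mxabs AA (@mxfun_quasi_idempotent _ _ (r ^+ 2)%:C (r^-1)%:C)//.
  - rewrite scalerA -rmorphM /=; congr (_%:C *: _).
    by have [->|rn0] := eqVneq r 0; rewrite ?invr0 ?mul0r// expr2 mulKf.
  - by rewrite sqrtC0.
  - rewrite rmorphXn /= sqrCK ?ler0c// -rmorphXn -rmorphM /=; congr _%:C.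
    by have [->|rn0] := eqVneq r 0; rewrite ?invr0 ?mul0r// expr2 mulKf.
have powE : mxpowR (mxabs A) q = (r `^ q)%:C *: Q.
  have rq : r `^ q = r `^ q / r * r.
    have [->|rn0] := eqVneq r 0; last by rewrite mulfVK.
    by rewrite powR0// mulr0.
  rewrite absE /mxpowR (@mxfun_quasi_idempotent _ _ r%:C (r `^ q / r)%:C)//=.
  - by rewrite scalerA -rmorphM -rq.
  - by rewrite powR0.
  - by rewrite -rmorphM -rq.
by rewrite /schatten_norm powE linearZ /= trQ mulr1 /= -powRrM divff// powRr1.
Qed.

End SchattenNorm.

(** * The trace norm of the triangular matrix *)

Section CosineBounds.
Context {R : realType}.
Implicit Types t : R.

Lemma cos_half t : cos t = 1 - 2 * sin (t / 2) ^+ 2.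
Proof.
have {1}-> : t = (t / 2) *+ 2 by rewrite -mulr_natr mulfVK.
by rewrite cos_mulr2n cos2sin2; ring.
Qed.

Lemma norm_sin_le t : `|sin t| <= `|t|.
Proof.
wlog t0 : t / 0 < t => [h|].
  have [/h//|t0|<-] := ltgtP 0 t; last by rewrite sin0.
  by rewrite -normrN -sinN -[leRHS]normrN; apply: h; rewrite oppr_gt0.
have [x _] : exists2 x, x \in `]0, t[%R & sin t - sin 0 = cos x * (t - 0).
  by apply: MVT => //; apply: continuous_subspaceT; exact: continuous_sin.
rewrite sin0 !subr0 => ->; rewrite normrM ler_piMl//; exact: cos_max.
Qed.

(** The half-angle formula reduces this to [|sin x| <= |x|]. It yields both the bound of a chord by
    its arc and [fejer <= 1]. *)
Lemma onemcos_le t : 2 * (1 - cos t) <= t ^+ 2.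
Proof.
rewrite cos_half.
have -> : t ^+ 2 = 4 * (t / 2) ^+ 2 by field.
have : sin (t / 2) ^+ 2 <= (t / 2) ^+ 2.
  rewrite -[leLHS]real_normK ?num_real// -[leRHS]real_normK ?num_real//.
  by rewrite lerXn2r ?nnegrE ?norm_sin_le.
lra.
Qed.

Lemma cos_lt1 t : 0 < `|t| -> `|t| < 2 * pi -> cos t < 1.
Proof.
move=> t0 t2; rewrite -cos_norm cos_half.
suff : 0 < sin (`|t| / 2) ^+ 2 by lra.
rewrite exprn_gt0// sin_gt0_pi//; apply/andP; split; lra.
Qed.

End CosineBounds.

Section ComplexExponential.
Context {R : realType}.
Implicit Types (s t : R) (n : nat).

Lemma expi0 : expi 0 = 1 :> R[i].
Proof. by rewrite /expi cos0 sin0. Qed.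

Lemma expiD s t : expi (s + t) = expi s * expi t.
Proof. by rewrite /expi cosD sinD; congr Complex; rewrite addrC. Qed.

Lemma expi_natr n t : expi (n%:R * t) = expi t ^+ n.
Proof.
elim: n => [|n IH]; first by rewrite mul0r expi0.
by rewrite -natr1 mulrDl mul1r expiD IH exprSr.
Qed.

Lemma conj_expi t : Num.conj (expi t) = expi (- t) :> R[i].
Proof. by rewrite /expi cosN sinN. Qed.

Lemma expi_2pi : expi (2 * pi) = 1 :> R[i].
Proof. by rewrite /expi mulr_natl cos2pi sin2pi. Qed.

Lemma norm_1Bexpi t : `|1 - expi t| <= `|t|%:C.
Proof.
rewrite normc_def lecR -(sqrtr_sqr t) ler_wsqrtr//=.
apply: le_trans (onemcos_le t).
have := cos2Dsin2 t; nra.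
Qed.

Lemma expi_neq1 t : 0 < `|t| -> `|t| < 2 * pi -> expi t != 1 :> R[i].
Proof.
by move=> t0 t2; rewrite eq_complex /= lt_eqF ?cos_lt1.
Qed.

End ComplexExponential.

Section RootsOfUnity.
Context {F : fieldType}.

Lemma sum_expr_root1 n (w : F) : w ^+ n = 1 -> w != 1 -> \sum_(i < n) w ^+ i = 0.
Proof.
move=> wn w1; apply/eqP; have := subrX1 w n.
by rewrite wn subrr => /esym/eqP; rewrite mulf_eq0 subr_eq0 (negbTE w1).
Qed.

Lemma sum_triangular_expr n (w : F) (j : 'I_n) :
  \sum_(l < n | (l <= j)%N) w ^+ (j - l) = \sum_(i < j.+1) w ^+ i.
Proof.
rewrite [RHS](reindex_inj rev_ord_inj) /=.
by rewrite (big_ord_widen n (fun i => w ^+ (j.+1 - i.+1))).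
Qed.

(** Each inner sum is geometric, equal to [(1 - w^(j+1)) / (1 - w)]; over all [j] the powers of [w]
    cancel and the ones add up to [n]. *)
Lemma sum_triangular_root1 n (w : F) : w ^+ n = 1 -> w != 1 ->
  \sum_(j < n) \sum_(l < n | (l <= j)%N) w ^+ (j - l) = n%:R / (1 - w).
Proof.
move=> wn w1; have w10 : 1 - w != 0 by rewrite subr_eq0 eq_sym.
apply: (mulIf w10); rewrite mulfVK// mulr_suml.
rewrite (eq_bigr (fun j : 'I_n => 1 - w * w ^+ j)) => [|j _].
  by rewrite sumrB -mulr_sumr sum_expr_root1// mulr0 subr0 sumr_const card_ord.
by rewrite sum_triangular_expr mulrC -opprB mulNr -subrX1 opprB exprS.
Qed.

End RootsOfUnity.

Section TriangularLowerBound.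
Local Open Scope sesquilinear_scope.
Context {R : realType} {N : nat}.
Context (N0 : (0 < N)%N).
Implicit Types (b : nat -> R) (k : nat).

Let theta k : R := 2 * pi * k%:R / N%:R.

Let N0R : (0 : R) < N%:R. Proof. by rewrite ltr0n. Qed.

Lemma expi_theta_root k : expi (theta k) ^+ N = 1 :> R[i].
Proof.
rewrite -expi_natr /theta mulrCA mulfV ?gt_eqF// mulr1 mulrC expi_natr.
by rewrite expi_2pi expr1n.
Qed.

Lemma theta_lt k : (k < N)%N -> theta k < 2 * pi.
Proof.
move=> kN; rewrite /theta ltr_pdivrMr// ltr_pM2l ?ltr_nat//.
by rewrite mulr_gt0// pi_gt0.
Qed.

Lemma theta_gt0 k : (0 < k)%N -> 0 < theta k.
Proof. by move=> k0; rewrite /theta divr_gt0 ?mulr_gt0 ?pi_gt0 ?ltr0n. Qed.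

Lemma theta_ge0 k : 0 <= theta k.
Proof. by rewrite /theta divr_ge0 ?mulr_ge0 ?pi_ge0. Qed.

Let sqrtNV2 : (Num.sqrt N%:R)^-1%:C * (Num.sqrt N%:R)^-1%:C = (N%:R : R[i])^-1.
Proof.
by rewrite -rmorphM /= -invfM -expr2 sqr_sqrtr ?ler0n// fmorphV rmorph_nat.
Qed.

(** The discrete Fourier matrix times the diagonal unitary with entries [expi (b j)]; the twist
    absorbs the phases of the triangular matrix. *)
Definition twisted_dft b : 'M[R[i]]_N :=
  \matrix_(k, j) ((Num.sqrt N%:R)^-1%:C * expi (theta k * j%:R + b j)).

Lemma twisted_dft_unitary b : twisted_dft b \is unitarymx.
Proof.
apply/unitarymxP/matrixP => k k'; rewrite !mxE.
under eq_bigr => j _.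
  rewrite !mxE rmorphM /= conj_expi (CrealP _) ?complex_real//.
  rewrite mulrACA sqrtNV2 -expiD.
  rewrite (_ : _ + _ + _ = j%:R * (theta k - theta k')); last by ring.
  rewrite expi_natr.
  over.
rewrite -mulr_sumr; have [<-|kk'] := eqVneq k k'.
  rewrite subrr expi0; under eq_bigr do rewrite expr1n.
  by rewrite sumr_const card_ord mulVf ?pnatr_eq0 ?gtn_eqF.
have root1 : expi (theta k - theta k') ^+ N = 1 :> R[i].
  rewrite expiD exprMn expi_theta_root mul1r -conj_expi -rmorphXn /=.
  by rewrite expi_theta_root rmorph1.
(* Distinct indices below [N] have angles differing by a nonzero amount less than a full turn. *)
rewrite sum_expr_root1 ?mulr0//; apply: expi_neq1.
  rewrite normr_gt0 subr_eq0 /theta (inj_eq (mulIf _)) ?invr_eq0 ?(gt_eqF N0R)//.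
  rewrite (inj_eq (mulfI _)) ?eqr_nat//.
  by rewrite gt_eqF// mulr_gt0// pi_gt0.
have := theta_lt _ (ltn_ord k); have := theta_lt _ (ltn_ord k').
have := theta_ge0 k; have := theta_ge0 k'.
by rewrite ltr_norml => *; apply/andP; split; lra.
Qed.

Lemma double_sum_succ n : ((\sum_(j < n) j.+1) * 2 = n * n.+1)%N.
Proof.
elim: n => [|n IH]; first by rewrite big_ord0.
by rewrite big_ord_recr mulnDl IH (mulnC n) -mulnDr addn2.
Qed.

(** By induction: passing to the next integer adds [ln (1 + 1/(n+1))] on the left, at most the new
    term [1/(n+1)] on the right. *)
Lemma ln_le_harmonic n : ln n.+1%:R <= \sum_(1 <= k < n.+1) k%:R^-1 :> R.
Proof.
elim: n => [|n IH]; first by rewrite ln1 big_geq.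
rewrite big_nat_recr//=; apply: le_trans (lerD IH (lexx _)).
have -> : n.+2%:R = n.+1%:R * (1 + n.+1%:R^-1) :> R.
  by rewrite mulrDr mulr1 mulfV// -natr1.
rewrite lnM ?posrE ?addr_gt0 ?invr_gt0 ?ltr0n// lerD2l.
by apply: le_ln1Dx; rewrite (lt_trans (ltrN10 _)) ?invr_gt0.
Qed.

(** The summand [2^-1] comes from the zero frequency and the logarithm from the others. The former
    makes the final inequality strict, also for [N = 1]. *)
Lemma schatten_norm1_triangular (kappa : R) (a d : nat -> R) : 0 < kappa ->
  kappa * (2^-1 + (2 * pi)^-1 * ln N%:R) <= schatten_norm 1
    (\matrix_(j < N, l < N)
       ((kappa / N%:R)%:C * expi (a j + d l) *+ (l <= j)%N)).
Proof.
move=> kappa0; set T := \matrix_(j, l) _.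
(* The twists by [a] and [- d] cancel the phases [a j + d l], so the diagonal entries only see the
   powers of a root of unity. *)
pose E := twisted_dft a ^ Num.conj.
pose F := (twisted_dft (fun l => - d l))^T.
have Eu : E \is unitarymx by rewrite conjC_unitary twisted_dft_unitary.
have Fu : F \is unitarymx by rewrite trmx_unitary twisted_dft_unitary.
have diagE (k : 'I_N) : (E *m T *m F) k k =
    (kappa / N%:R)%:C / N%:R *
    \sum_(j < N) \sum_(l < N | (l <= j)%N) expi (- theta k) ^+ (j - l).
  rewrite mxE; under eq_bigr => l _ do rewrite mxE mulr_suml.
  rewrite exchange_big mulr_sumr; apply: eq_bigr => j _ /=.
  rewrite mulr_sumr [RHS]big_mkcond /=; apply: eq_bigr => l _; rewrite !mxE.
  case: leqP => [lj|_]; last by rewrite mulr0n mulr0 mul0r.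
  rewrite mulr1n rmorphM /= conj_expi (CrealP _) ?complex_real//.
  rewrite -expi_natr natrB// -sqrtNV2.
  rewrite (_ : (j%:R - l%:R) * - theta k = - (theta k * j%:R + a j) +
    (a j + d l) + (theta k * l%:R + - d l)); last by ring.
  by rewrite !expiD; ring.
(* At [k = 0] the root is one and the entry counts the triangle: it equals
   [kappa (N + 1) / (2 N)]. *)
have diag0 (k : 'I_N) : k = 0 :> nat -> (kappa / 2)%:C <= `|(E *m T *m F) k k|.
  move=> k0; rewrite diagE /theta k0 mulr0 mul0r oppr0 expi0.
  under eq_bigr => j _.
    rewrite sum_triangular_expr.
    under eq_bigr do rewrite expr1n.
    rewrite sumr_const card_ord.
    over.
  rewrite -natr_sum; set S := (\sum_(j < N) _)%N.
  have -> : (kappa / N%:R)%:C / N%:R * S%:R = (kappa / N%:R / N%:R * S%:R)%:C.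
    by rewrite [RHS]rmorphM [X in _ = X * _]rmorphM /= fmorphV !rmorph_nat.
  rewrite ger0_norm; last first.
    by rewrite ler0c mulr_ge0// !divr_ge0// ltW.
  rewrite lecR -!mulrA ler_pM2l//.
  have /(congr1 (fun n => n%:R : R)) := double_sum_succ N.
  rewrite natrM natrM -(natr1 N) => S2.
  rewrite mulrA -invfM ler_pdivlMl ?mulr_gt0//.
  have := N0R; nra.
(* The entry is [kappa / (N (1 - expi (- theta k)))], and the chord in the denominator is at most
   the arc [theta k]. *)
have diagS (k : 'I_N) : (0 < k)%N ->
    (kappa / (2 * pi) / k%:R)%:C <= `|(E *m T *m F) k k|.
  move=> k0; rewrite diagE sum_triangular_root1; first last.
  - by rewrite expi_neq1// normrN gtr0_norm ?theta_gt0// theta_lt.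
  - by rewrite -conj_expi -rmorphXn /= expi_theta_root rmorph1.
  rewrite mulrA mulfVK ?pnatr_eq0 ?gtn_eqF// normrM normfV.
  rewrite ger0_norm ?ler0c ?divr_ge0 ?(ltW kappa0)//.
  have -> : kappa / (2 * pi) / k%:R = kappa / N%:R / theta k.
    rewrite /theta; move: (pi_gt0 R); generalize (@pi R) => p p0.
    by field; rewrite !pnatr_eq0 !gtn_eqF// gt_eqF.
  rewrite rmorphM fmorphV /= ler_pM2l ?(ltcR 0) ?divr_gt0//.
  have th0 : (theta k)%:C \is Num.pos by rewrite posrE (ltcR 0) theta_gt0.
  have nw0 : `|1 - expi (- theta k)| \is Num.pos.
    rewrite posrE normr_gt0 subr_eq0 eq_sym.
    by rewrite expi_neq1// normrN gtr0_norm ?theta_gt0// theta_lt.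
  rewrite (lef_pV2 th0 nw0) (le_trans (norm_1Bexpi _))//.
  by rewrite normrN ger0_norm ?theta_ge0.
have := sum_norm_diag_le_schatten_norm1 T _ _ Eu Fu.
rewrite -lecR; apply: le_trans.
pose g k := if (0 < k)%N then kappa / (2 * pi) / k%:R else kappa / 2.
apply: (@le_trans _ _ (\sum_(k < N) (g k)%:C)); last first.
  apply: ler_sum => k _; rewrite /g; case: posnP => [|] k0.
    exact: diag0.
  exact: diagS.
rewrite -rmorph_sum lecR -(big_mkord xpredT g) big_ltn// {1}/g ltnn.
rewrite (eq_big_nat _ _ (F2 := fun k => kappa / (2 * pi) * k%:R^-1)); last first.
  by move=> k /andP[k0 _]; rewrite /g k0.
rewrite -mulr_sumr mulrDr lerD2l mulrA ler_pM2l ?divr_gt0 ?mulr_gt0 ?pi_gt0//.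
by have := ln_le_harmonic N.-1; rewrite prednK.
Qed.

End TriangularLowerBound.

(** * Fourier transform of the tent function *)

Section TentTransform.
Local Open Scope classical_set_scope.
Context {R : realType}.
Notation mu := (@lebesgue_measure R).
Implicit Types s x a c p q u v : R.

Lemma continuous_affine_cos p q s c :
  continuous (fun x : R => (p + q * x) * cos (s * x + c)).
Proof.
move=> x; apply: cvgM.
  by apply: cvgD; [exact: cvg_cst|apply: cvgM; [exact: cvg_cst|exact: cvg_id]].
apply: (@continuous_comp _ _ _ (fun x => s * x + c) (@cos R)); last exact: continuous_cos.
by apply: cvgD; [apply: cvgM; [exact: cvg_cst|exact: cvg_id]|exact: cvg_cst].
Qed.

(** Obtained by one integration by parts. The tent is affine on each side of its peak, and the phase
    [c] lets the cosine stand for the sine too. *)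
Definition affine_cos_primitive p q s c x : R :=
  (p + q * x) * sin (s * x + c) / s + q * cos (s * x + c) / s ^+ 2.

Lemma is_derive_affine_cos_primitive p q s c x : s != 0 ->
  is_derive x 1 (affine_cos_primitive p q s c) ((p + q * x) * cos (s * x + c)).
Proof.
move=> s0.
have dl : is_derive x (1 : R) (fun x => s * x + c) s.
  by apply: is_derive_eq; rewrite scaler1 addr0.
have ds := @is_derive1_comp R (@sin R) (fun x => s * x + c) x _ _ (is_derive_sin _) dl.
have dc := @is_derive1_comp R (@cos R) (fun x => s * x + c) x _ _ (is_derive_cos _) dl.
have dp : is_derive x (1 : R) (fun x => p + q * x) q.
  by apply: is_derive_eq; rewrite add0r mul1r scaler1.
have scaleE (a b : R) : a *: b = a * b by [].
pose S := (@sin R \o (fun x => s * x + c)) : R -> R.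
pose K := (@cos R \o (fun x => s * x + c)) : R -> R.
pose P := (fun x => p + q * x) : R -> R.
have -> : affine_cos_primitive p q s c =
    s^-1 \*: (P * S) + (q / s ^+ 2) \*: K.
  apply/funext => y; rewrite !fctE /= !scaleE /P -[S y]/(sin (s * y + c)).
  by rewrite -[K y]/(cos (s * y + c)) /affine_cos_primitive; ring.
apply: is_derive_eq; rewrite /= -[S x]/(sin (s * x + c)) /P !scaleE.
by field.
Qed.

Lemma Rintegral_affine_cos p q s c u v : s != 0 -> u < v ->
  \int[mu]_(x in `[u, v]) ((p + q * x) * cos (s * x + c)) =
  affine_cos_primitive p q s c v - affine_cos_primitive p q s c u.
Proof.
move=> s0 uv; have dF x := is_derive_affine_cos_primitive p q s c x s0.
rewrite /Rintegral (@continuous_FTC2 _ _ (affine_cos_primitive p q s c))//.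
- by apply: continuous_subspaceT; exact: continuous_affine_cos.
- have cF : continuous (affine_cos_primitive p q s c).
    move=> x; apply: differentiable_continuous; apply/derivable1_diffP.
    by case: (dF x).
  split.
  + by move=> x _; case: (dF x).
  + by apply: cvg_at_right_filter; exact: cF.
  + by apply: cvg_at_left_filter; exact: cF.
- by move=> x _; rewrite derive1E; case: (dF x).
Qed.

Definition tent x : R := Num.max 0 (1 - `|x|).

Lemma tent_eq0 x : 1 <= `|x| -> tent x = 0.
Proof. by move=> x1; rewrite /tent max_l// subr_le0. Qed.

Lemma continuous_tent : continuous tent.
Proof.
move=> x; apply: (@continuous_max R R (fun=> 0) (fun x => 1 - `|x|)).
  exact: cvg_cst.
by apply: cvgB; [exact: cvg_cst|exact: norm_continuous].
Qed.

Lemma continuous_tent_cos a s c :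
  continuous (fun x : R => tent (x - a) * cos (s * x + c)).
Proof.
move=> x; apply: cvgM.
  apply: (@continuous_comp _ _ _ (fun x => x - a) tent); last exact: continuous_tent.
  by apply: cvgB; [exact: cvg_id|exact: cvg_cst].
apply: (@continuous_comp _ _ _ (fun x => s * x + c) (@cos R)); last exact: continuous_cos.
by apply: cvgD; [apply: cvgM; [exact: cvg_cst|exact: cvg_id]|exact: cvg_cst].
Qed.

Lemma restrict_tent_cos a s c :
  (fun x : R => tent (x - a) * cos (s * x + c)) \_ `[a - 1, a + 1] =
  (fun x => tent (x - a) * cos (s * x + c)).
Proof.
apply/funext => x; rewrite patchE; case: ifPn => // /negP.
rewrite inE/= in_itv/= => xa; rewrite tent_eq0 ?mul0r// leNgt ltr_norml.
by apply/negP => ?; apply: xa; lra.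
Qed.

Lemma integrable_tent_cos a s c :
  mu.-integrable setT (EFin \o (fun x => tent (x - a) * cos (s * x + c))).
Proof.
rewrite -restrict_tent_cos -restrict_EFin.
rewrite -integrable_mkcond//; apply: continuous_compact_integrable.
  exact: segment_compact.
by apply: continuous_subspaceT; exact: continuous_tent_cos.
Qed.

(* Junk value: [fejer 0 = 0], whereas the integral of [tent] is [1]. *)
Definition fejer s : R := 2 * (1 - cos s) / s ^+ 2.

Lemma Rintegral_tent_cos a s c : s != 0 ->
  \int[mu]_x (tent (x - a) * cos (s * x + c)) = cos (s * a + c) * fejer s.
Proof.
move=> s0; rewrite -restrict_tent_cos -Rintegral_mkcond.
have int_ D : measurable D ->
    mu.-integrable D (EFin \o (fun x => tent (x - a) * cos (s * x + c))).
  by move=> mD; apply: integrableS (integrable_tent_cos a s c).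
(* Split the support at the peak [a], where the affine formula for the tent changes. *)
have splitE := @Rintegral_itvB R (fun x => tent (x - a) * cos (s * x + c))
  (BLeft (a - 1)) (BRight (a + 1)) a (int_ _ (measurable_itv _)).
rewrite !bnd_simp lerBlDr lerDl ler01 in splitE.
have {splitE} /eqP := splitE isT isT; rewrite subr_eq => /eqP ->.
rewrite Rintegral_itv_obnd_cbnd; last exact: int_.
rewrite (@eq_Rintegral _ _ _ mu `[a, a + 1]
  (fun x => (1 + a + (-1) * x) * cos (s * x + c))); last first.
  move=> x; rewrite inE/= in_itv/= => xa; congr (_ * _).
  by rewrite /tent ger0_norm ?max_r; lra.
rewrite (@eq_Rintegral _ _ _ mu `[a - 1, a]
  (fun x => (1 - a + 1 * x) * cos (s * x + c))); last first.
  move=> x; rewrite inE/= in_itv/= => xa; congr (_ * _).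
  by rewrite /tent ler0_norm ?max_r; lra.
rewrite !Rintegral_affine_cos ?ltrBlDr ?ltrDl//.
rewrite /affine_cos_primitive /fejer.
have -> : s * (a + 1) + c = (s * a + c) + s by ring.
have -> : s * (a - 1) + c = (s * a + c) - s by ring.
by rewrite cosD cosB; field.
Qed.

End TentTransform.

(** * Matrix-valued shifted tents and their inverse Fourier transforms *)

Section ShiftedTents.
Local Open Scope classical_set_scope.
Local Open Scope sesquilinear_scope.
Context {R : realType}.
Notation mu := (@lebesgue_measure R).
Implicit Types (s x a c w : R) (alpha beta : nat -> R).

Definition cintegral (f : R -> R[i]) : R[i] :=
  (\int[mu]_x complex.Re (f x)) +i* (\int[mu]_x complex.Im (f x)).

Lemma mx_integralE N (f : R -> 'M[R[i]]_N) i j :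
  mx_integral f i j = cintegral (fun x => f x i j).
Proof. by rewrite mxE. Qed.

(** The complex factor [z] holds whatever is constant in [x], so that the same formula serves for
    both stages of the iterated integral. *)
Lemma cintegral_tent z a s : s != 0 ->
  cintegral (fun x => z * (expi (s * x) * (tent (x - a))%:C)) =
  z * (expi (s * a) * (fejer s)%:C).
Proof.
move=> s0; case: z => p q; rewrite /cintegral.
have int_ c k : mu.-integrable setT
    (EFin \o (fun x => k * (tent (x - a) * cos (s * x + c)))).
  exact: (integrableZl measurableT k (integrable_tent_cos a s c)).
(* Sines become cosines with a shifted phase, so both real and imaginary parts fall under
   [Rintegral_tent_cos]. *)
have sinE t : sin t = cos (t + - (pi / 2)) by rewrite cosBpihalf.
have E1 x : complex.Re ((p +i* q) * (expi (s * x) * (tent (x - a))%:C)) =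
    p * (tent (x - a) * cos (s * x + 0)) -
    q * (tent (x - a) * cos (s * x + - (pi / 2))).
  by rewrite /= -sinE addr0; ring.
have E2 x : complex.Im ((p +i* q) * (expi (s * x) * (tent (x - a))%:C)) =
    p * (tent (x - a) * cos (s * x + - (pi / 2))) +
    q * (tent (x - a) * cos (s * x + 0)).
  by rewrite /= -sinE addr0; ring.
under eq_Rintegral do rewrite E1.
under [X in _ +i* X]eq_Rintegral do rewrite E2.
rewrite RintegralB ?RintegralD//; try exact: int_.
rewrite !RintegralZl//; try exact: integrable_tent_cos.
rewrite !Rintegral_tent_cos// addr0 -sinE /expi.
by apply/eqP; rewrite eq_complex /=; apply/andP; split; apply/eqP; ring.
Qed.

(** Shifts depending on both indices cover both arguments: [beta = 0] gives the first function and
    [alpha = 0] the second. *)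
Definition shifted_tents N w alpha beta x : 'M[R[i]]_N :=
  \matrix_(j, k) (w * tent (x - (alpha j + beta k)))%:C.

Definition modulated_fejer N w alpha beta s : 'M[R[i]]_N :=
  \matrix_(j, k) ((w * fejer s)%:C * expi (s * (alpha j + beta k))).

Lemma inv_fourier_shifted_tents N w alpha beta s : s != 0 ->
  inv_fourier (@shifted_tents N w alpha beta) s = modulated_fejer N w alpha beta s.
Proof.
move=> s0; apply/matrixP => j k; rewrite mx_integralE mxE.
rewrite rmorphM -mulrA [_ * expi _]mulrC -cintegral_tent//.
congr cintegral; apply/funext => x; rewrite !mxE rmorphM /=; ring.
Qed.

Lemma continuous_real_complex : continuous (fun x => x%:C : R[i]^o).
Proof.
move=> x; apply/cvgrPdist_lt => -[e f]; rewrite ltcE /= => /andP[/eqP -> e0].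
near=> y.
rewrite -rmorphB /= normc_def /= expr0n addr0 sqrtr_sqr ltcR.
near: y; exact: cvgr_dist_lt.
Unshelve. all: by end_near. Qed.

Lemma continuous_mx (T : topologicalType) (S : uniformType) m n
    (f : T -> 'M[S]_(m, n)) :
  (forall i j, continuous (fun t : T => f t i j)) -> continuous f.
Proof.
move=> cf t B [P nP PB].
have : \forall y \near t, forall i j, P i j (f y i j).
  apply: filter_forall => i; apply: filter_forall => j.
  exact: (cf i j t _ (nP i j)).
by apply: filterS => y Py; exact: PB.
Qed.

Lemma has_fourier_modulated_fejer N w alpha beta :
  has_fourier_Cc (modulated_fejer N w alpha beta) (@shifted_tents N w alpha beta).
Proof.
split.
- apply: continuous_mx => j k x.
  rewrite (_ : (fun x => _) = (fun x => (w * tent (x - (alpha j + beta k)))%:C)); last first.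
    by apply/funext => y; rewrite mxE.
  apply: (@continuous_comp _ _ _ (fun y => w * tent (y - (alpha j + beta k)))
    (fun y => y%:C : R[i]^o)); last exact: continuous_real_complex.
  apply: cvgM; first exact: cvg_cst.
  apply: (@continuous_comp _ _ _ (fun y => y - _) tent); last exact: continuous_tent.
  by apply: cvgB; [exact: cvg_id|exact: cvg_cst].
(* [M] dominates every shift, so all the tents live in the segment of radius [M + 1]. *)
- pose M := \sum_(j < N) \sum_(k < N) `|alpha j + beta k|.
  have MP (j k : 'I_N) : `|alpha j + beta k| <= M.
    rewrite /M (bigD1 j)//= (bigD1 k)//= -addrA lerDl addr_ge0 ?sumr_ge0// => i _.
    exact: sumr_ge0.
  apply: (@subclosed_compact _ _ `[- (M + 1), M + 1]).
  + exact: closed_closure.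
  + exact: segment_compact.
  + have /closure_id -> : closed `[- (M + 1), M + 1] by exact: itv_closed.
    apply: closure_subset => x /=; apply: contraPP; rewrite in_itv/= => xM.
    apply/negP/negPn/eqP/matrixP => j k; rewrite !mxE tent_eq0 ?mulr0//.
    rewrite leNgt; apply/negP; rewrite ltr_norml => xa; apply: xM.
    have := MP j k; rewrite ler_norml; lra.
(* The default value [fejer 0 = 0] can spoil the inversion formula at the origin only, a null
   set. *)
- exists [set 0]; split => //; first exact: lebesgue_measure_set1.
  move=> s /=; apply: contra_notP => s0.
  by rewrite inv_fourier_shifted_tents//; exact/eqP.
Qed.

End ShiftedTents.

(** * The multiplier on shifted tents *)

Section BilinearMultiplierOfTents.
Local Open Scope classical_set_scope.
Local Open Scope sesquilinear_scope.
Context {R : realType} {N : nat}.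
Implicit Types (s x k w : R) (alpha beta : nat -> R).

Lemma chi_ge0E x : chi_ge0 x = (0 <= x)%R%:R.
Proof. by rewrite /chi_ge0 indicE; congr (_%:R); rewrite mem_setE in_itv/= andbT. Qed.

Lemma tent_neq0 x : tent x != 0 -> `|x| < 1.
Proof. by rewrite ltNge; apply: contra_neqN => /tent_eq0. Qed.

(** A row shift exceeds a column shift by [8 (j - l) + 4], which is at least 4 if [l <= j] and at
    most -4 otherwise. On the supports [x - y] is within 2 of this difference, so its sign is
    determined. *)
Let row_shift (j : nat) : R := 8 * j%:R + 4.
Let col_shift (l : nat) : R := 8 * l%:R.

Lemma chi_ge0_tent (j l : nat) x y :
  chi_ge0 (x - y) * (tent (x - row_shift j) * tent (y - col_shift l)) =
  (l <= j)%N%:R * (tent (x - row_shift j) * tent (y - col_shift l)).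
Proof.
have [->|/tent_neq0] := eqVneq (tent (x - row_shift j)) 0.
  by rewrite mul0r !mulr0.
have [->|/tent_neq0] := eqVneq (tent (y - col_shift l)) 0.
  by rewrite !mulr0.
rewrite /row_shift /col_shift !ltr_norml => yl xj.
congr (_ * _); rewrite chi_ge0E; congr (nat_of_bool _)%:R.
have [lj|lj] := leqP l j.
  have : l%:R <= j%:R :> R by rewrite ler_nat.
  by move=> ?; apply/idP; lra.
have : j.+1%:R <= l%:R :> R by rewrite ler_nat.
by rewrite -natr1 => ?; apply/negbTE; rewrite -ltNge; lra.
Qed.

(** By [chi_ge0_tent] the symbol is constant on each product of tents, so the double integral
    factors into two single ones. *)
Lemma bilinear_multiplier_tents w1 w2 s : s != 0 ->
  bilinear_multiplier (fun x y : R => (chi_ge0 (x - y))%:C)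
    (@shifted_tents R N w1 row_shift (fun=> 0))
    (@shifted_tents R N w2 (fun=> 0) col_shift) s =
  \matrix_(j, l) ((N%:R * (w1 * w2) * fejer s ^+ 2)%:C *
     expi (s * row_shift j + s * col_shift l) *+ (l <= j)%N).
Proof.
move=> s0; apply/matrixP => j l; rewrite mx_integralE mxE.
pose c := (l <= j)%N%:R * (N%:R * (w1 * w2))%:C *
  (expi (s * row_shift j) * (fejer s)%:C).
transitivity (cintegral (fun y : R =>
  c * (expi (s * y) * (tent (y - col_shift l))%:C))).
  congr cintegral; apply/funext => y; rewrite mx_integralE.
  pose z := (l <= j)%N%:R * (N%:R * (w1 * w2))%:C *
    (expi (s * y) * (tent (y - col_shift l))%:C).
  transitivity (cintegral (fun x : R =>
    z * (expi (s * x) * (tent (x - row_shift j))%:C))).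
    congr cintegral; apply/funext => x; rewrite !mxE.
    (* The terms of the matrix product do not depend on the middle index, whence the factor [N]. *)
    rewrite (eq_bigr (fun=> (w1 * w2)%:C *
      (tent (x - row_shift j) * tent (y - col_shift l))%:C)); last first.
      by move=> k _; rewrite !mxE addr0 add0r -!rmorphM mulrACA.
    rewrite sumr_const card_ord -mulr_natl mulrDr expiD.
    rewrite (_ : _ * _ = (chi_ge0 (x - y) *
        (tent (x - row_shift j) * tent (y - col_shift l)))%:C *
      (N%:R * ((w1 * w2)%:C * (expi (s * x) * expi (s * y))))); last first.
      by rewrite [in RHS]rmorphM /=; ring.
    by rewrite chi_ge0_tent /z !rmorphM !rmorph_nat /=; ring.
  by rewrite cintegral_tent// /z /c; ring.
rewrite cintegral_tent// /c expiD; case: leqP => _; last by rewrite !mul0r mulr0n.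
by rewrite mulr1n !rmorphM rmorph_nat /=; ring.
Qed.

Lemma fejer_ge0 s : 0 <= fejer s.
Proof. by rewrite /fejer divr_ge0 ?sqr_ge0// mulr_ge0// subr_ge0 cos_le1. Qed.

(** The phases divided by [N] form a rank one partial isometry; [Q] is the projection onto the line
    of the unit vector with entries [expi (- s * beta i) / sqrt N]. *)
Lemma schatten_norm_modulated_fejer q k alpha beta s :
  (0 < N)%N -> q != 0 -> 0 <= k ->
  schatten_norm q (@modulated_fejer R N (k / N%:R) alpha beta s) = k * fejer s.
Proof.
move=> N0 q0 k0.
have NV : N%:R * (N%:R : R[i])^-1 = 1 by rewrite mulfV// pnatr_eq0 gtn_eqF.
pose Q : 'M[R[i]]_N := \matrix_(i, j) (N%:R^-1 * expi (s * beta j - s * beta i)).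
apply: (@schatten_norm_rank1 _ _ _ Q) => //.
- by rewrite mulr_ge0// fejer_ge0.
- apply/matrixP => i j; rewrite !mxE.
  rewrite (eq_bigr (fun=> N%:R^-1 * (N%:R^-1 * expi (s * beta j - s * beta i)))).
    by rewrite sumr_const card_ord -[LHS]mulr_natl mulrA NV mul1r.
  move=> l _; rewrite !mxE mulrACA -expiD -mulrA; congr (_ * (_ * expi _)); ring.
- apply/matrixP => i j; rewrite !mxE rmorphM /= conj_expi opprB fmorphV rmorph_nat.
  by [].
- rewrite /mxtrace (eq_bigr (fun=> N%:R^-1)) => [|i _].
    by rewrite sumr_const card_ord -[LHS]mulr_natl.
  by rewrite mxE subrr expi0 mulr1.
- apply/matrixP => i j; rewrite !mxE.
  rewrite (eq_bigr (fun=> ((k * fejer s) ^+ 2)%:C * N%:R^-1 *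
    (N%:R^-1 * expi (s * beta j - s * beta i)))).
    rewrite sumr_const card_ord -[LHS]mulr_natl mulrA.
    by rewrite [N%:R * _]mulrCA NV mulr1.
  move=> l _; rewrite !mxE rmorphM /= conj_expi (CrealP _) ?complex_real//.
  rewrite mulrACA -expiD (_ : - _ + _ = s * beta j - s * beta i); last by ring.
  rewrite [RHS]mulrA; congr (_ * _).
  rewrite -rmorphM /= -(rmorph_nat (real_complex R)) -fmorphV -!rmorphM /=.
  by congr _%:C; ring.
Qed.

End BilinearMultiplierOfTents.

(** * Bounds on the Fejer kernel and Bochner norms of the test functions *)

Section FejerNorms.
Local Open Scope classical_set_scope.
Context {R : realType}.
Notation mu := (@lebesgue_measure R).
Implicit Types (s p : R).

Lemma fejer_le1 s : fejer s <= 1.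
Proof.
have [->|s0] := eqVneq s 0; first by rewrite /fejer expr0n/= invr0 mulr0.
by rewrite /fejer ler_pdivrMr ?mul1r ?onemcos_le// exprn_even_gt0.
Qed.

(** Add [fejer s <= 1] and [s ^ 2 * fejer s = 2 (1 - cos s) <= 4]. *)
Lemma fejer_le_oneDsqrV s : fejer s <= 5 * (oneDsqr s)^-1.
Proof.
rewrite ler_pdivlMr ?oneDsqr_gt0// /oneDsqr mulrDr mulr1.
have [->|s0] := eqVneq s 0; first by rewrite /fejer expr0n/= invr0 !mulr0 addr0.
rewrite /fejer mulfVK ?sqrf_eq0//.
have := fejer_le1 s; rewrite /fejer; have := cos_geN1 s; lra.
Qed.

(** The cosine decreases on [[1, 2]], since [2 <= pi], and the denominator is at most 4. *)
Lemma fejer_ge s : 1 <= s <= 2 -> (1 - cos 1) / 2 <= fejer s.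
Proof.
move=> /andP[s1 s2]; rewrite /fejer ler_pdivlMr ?exprn_gt0 ?(lt_le_trans ltr01)//.
have cs : cos s <= cos 1.
  have pi2 := @pi_ge2 R.
  have [<-//|s1'] := eqVneq 1 s.
  by rewrite ltW// ltr_cos ?in_itv/= ?lt_neqAle ?s1'//; apply/andP; split; lra.
have c1 : 0 <= 1 - cos 1 :> R by rewrite subr_ge0 cos_le1.
have s4 : 0 <= 4 - s ^+ 2 by nra.
by have := mulr_ge0 c1 s4; lra.
Qed.

(** [fejer] is continuous off the origin, and the singleton left over is treated apart. *)
Lemma measurable_fejer : measurable_fun setT (@fejer R).
Proof.
rewrite -(setUv [set 0]); apply/measurable_funU => //; first exact: measurableC.
split; first exact: measurable_fun_set1.
apply: open_continuous_measurable_fun => [|s].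
  by apply: closed_openC; exact/accessible_closed_set1/hausdorff_accessible/Rhausdorff.
rewrite inE/= => /eqP s0; apply: cvgM.
  apply: cvgM; first exact: cvg_cst.
  by apply: cvgB; [exact: cvg_cst|exact: continuous_cos].
by apply: cvgV; [rewrite sqrf_eq0|exact: exprn_continuous].
Qed.

Lemma integralT_oneDsqrV : (\int[mu]_x ((oneDsqr x)^-1)%:E = (pi : R)%:E)%E.
Proof.
rewrite ge0_symfun_integralT.
- rewrite (_ : [set x | _] = `[0, +oo[%classic); last first.
    by apply/seteqP; split => x/=; rewrite in_itv/= andbT.
  by rewrite integral0y_oneDsqr -EFinM mulrCA divff// mulr1.
- by move=> x; rewrite invr_ge0 ltW// oneDsqr_gt0.
- exact: continuous_oneDsqrV.
- by move=> x; rewrite /= /oneDsqr sqrrN.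
Qed.

(* Unlike [ge0_le_integral], this requires no measurability. *)
Lemma le_integral_setT (f g : R -> \bar R) : (forall x, 0 <= f x)%E ->
  (forall x, f x <= g x)%E -> (\int[mu]_x f x <= \int[mu]_x g x)%E.
Proof.
move=> f0 fg; have g0 x : (0 <= g x)%E by exact: le_trans (f0 x) (fg x).
rewrite !ge0_integralTE//; apply: ereal_sup_le => _ [h hf <-].
by exists h => // x; exact: le_trans (hf x) (fg x).
Qed.

(* With this constant, [fejer s <= 1] and [fejer s <= 5 / (1 + s ^ 2)] give
   [(k p * fejer s) ^ p <= 1 / (pi (1 + s ^ 2))], a probability density. *)
Let k p : R := (5 * pi) `^ (- p^-1).

Lemma bochner_norm_modulated_fejer N p alpha beta : (0 < N)%N -> 1 < p ->
  (bochner_norm p (@modulated_fejer R N (k p / N%:R) alpha beta) <= 1)%E.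
Proof.
move=> N0 p1; have p0 : 0 < p by exact: lt_trans ltr01 p1.
have pi0 : 0 < 5 * pi :> R by rewrite mulr_gt0// pi_gt0.
have k0 : 0 <= k p by exact: powR_ge0.
rewrite /bochner_norm unlock.
under eq_integral do rewrite schatten_norm_modulated_fejer ?gt_eqF//.
rewrite -[leRHS](poweR1r p^-1); apply: gt0_ler_poweR.
- by rewrite invr_ge0 ltW.
- by rewrite in_itv/= leey integral_ge0// => x _; exact: poweR_ge0.
- by rewrite in_itv/= leey lee01.
apply: (@le_trans _ _ (\int[mu]_x (pi^-1 * (oneDsqr x)^-1)%:E)%E).
  apply: le_integral_setT => x; first exact: poweR_ge0.
  rewrite abse_EFin poweR_EFin lee_fin ger0_norm; last exact: mulr_ge0 k0 (fejer_ge0 x).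
  rewrite powRM ?fejer_ge0// /k -powRrM mulNr mulVf ?gt_eqF// powR_inv1 ?(ltW pi0)//.
  have := fejer_le_oneDsqrV x.
  have : fejer x `^ p <= fejer x.
    have [->|f0] := eqVneq (fejer x) 0; first by rewrite powR0// gt_eqF.
    rewrite -[leRHS]powRr1 ?fejer_ge0// ger_powR ?fejer_le1 ?(ltW p1)//.
    by rewrite lt_neqAle eq_sym f0 fejer_ge0.
  move=> /le_trans h /h {}h.
  rewrite ler_pdivrMl// [leRHS]mulrA mulfK//.
  by rewrite gt_eqF ?pi_gt0.
under eq_integral do rewrite EFinM.
rewrite ge0_integralZl//.
- by rewrite integralT_oneDsqrV -EFinM mulVf// gt_eqF// pi_gt0.
- apply/measurable_EFinP; apply: continuous_measurable_fun.
  exact: continuous_oneDsqrV.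
- by rewrite lee_fin invr_ge0 pi_ge0.
Qed.

Lemma mx_measurable_modulated_fejer N w alpha beta :
  mx_measurable (@modulated_fejer R N w alpha beta).
Proof.
have mcs (f : R -> R) c : continuous f ->
    measurable_fun setT (fun s => w * fejer s * f (s * c)).
  move=> cf; apply: measurable_funM.
    by apply: measurable_funM => //; exact: measurable_fejer.
  apply: continuous_measurable_fun => s.
  apply: (@continuous_comp _ _ _ (fun s => s * c) f); last exact: cf.
  by apply: cvgM; [exact: cvg_id|exact: cvg_cst].
move=> i j; split.
  rewrite (_ : (fun s => _) = fun s => w * fejer s * cos (s * (alpha i + beta j))).
    by apply: mcs; exact: continuous_cos.
  by apply/funext => s; rewrite mxE /= mul0r subr0.
rewrite (_ : (fun s => _) = fun s => w * fejer s * sin (s * (alpha i + beta j))).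
  by apply: mcs; exact: continuous_sin.
by apply/funext => s; rewrite mxE /= mul0r addr0.
Qed.

End FejerNorms.

(** * The logarithmic lower bound *)

(** The interval [[1, 2]] has measure one, so a pointwise bound there passes unchanged to the
    integral. *)
Lemma bochner_norm1_ge (R : realType) (N : nat) (f : R -> 'M[R[i]]_N) (L : R) :
  0 <= L -> (forall s, 1 <= s <= 2 -> L <= schatten_norm 1 (f s)) ->
  (L%:E <= bochner_norm 1 f)%E.
Proof.
move=> L0 fL; rewrite /bochner_norm Lnorm1.
have -> : L%:E = (\int[@lebesgue_measure R]_x (cst L%:E \_ `[1%R, 2%R]) x)%E.
  rewrite -integral_mkcond integral_cst//= lebesgue_measure_itv/= lte_fin ltr1n.
  by rewrite -EFinB (_ : 2 - 1 = 1) ?mule1//; ring.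
apply: le_integral_setT => s; rewrite patchE.
  by case: ifP => //=; rewrite lee_fin.
case: ifPn => [|_]; last exact: abse_ge0.
rewrite inE/= in_itv/= => s12.
by rewrite lee_fin (le_trans _ (ler_norm _))// fL.
Qed.

Theorem theorem3 (R : realType) :
  exists C : R, 0 < C /\
  forall p1 p2 : R, 1 < p1 -> 1 < p2 -> p1^-1 + p2^-1 = 1 ->
  forall N : nat, (1 <= N)%N ->
    ((C * ln (N%:R : R))%:E
      < multiplier_norm (fun s t : R => (chi_ge0 (s - t))%:C) N p1 p2 1)%E.
Proof.
pose m : R := (1 - cos 1) / 2.
have m0 : 0 < m.
  rewrite divr_gt0// subr_gt0; apply: cos_lt1; rewrite normr1//.
  by have := @pi_ge2 R; lra.
have pi0 := @pi_gt0 R.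
have fivepi0 : 0 < 5 * pi :> R by rewrite mulr_gt0.
have twopi0 : 0 < 2 * pi :> R by rewrite mulr_gt0.
(* [K] bounds from below the scalar [k p1 * k p2 * fejer s ^ 2] in front of the triangular matrix,
   for [s] in [[1, 2]]. *)
pose K : R := (5 * pi)^-1 * m ^+ 2.
have K0 : 0 < K by rewrite mulr_gt0 ?invr_gt0// exprn_gt0.
exists (K * (2 * pi)^-1); split; first by rewrite mulr_gt0// invr_gt0.
move=> p1 p2 p1gt1 p2gt1 p12 N N0.
pose k p : R := (5 * pi) `^ (- p^-1).
(* As the inverse exponents add up to one, the product of the normalisations is free of [p1] and
   [p2]; this makes the constant absolute. *)
have kk : k p1 * k p2 = (5 * pi)^-1.
  rewrite /k -powRD; last by apply/implyP => _; rewrite gt_eqF.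
  by rewrite -opprD p12 powR_inv1// ltW.
pose r (j : nat) : R := 8 * j%:R + 4.
pose c (l : nat) : R := 8 * l%:R.
pose z (n : nat) : R := 0.
have in_Lp p alpha beta : 1 < p ->
    in_bochner_Lp p (@modulated_fejer R N (k p / N%:R) alpha beta).
  move=> p_gt1; split; first exact: mx_measurable_modulated_fejer.
  by apply: le_lt_trans (bochner_norm_modulated_fejer _ _ _ _ N0 p_gt1) (ltry _).
(* The positive summand [K / 2] gives the strict inequality. *)
apply: (@lt_le_trans _ _ (K * (2^-1 + (2 * pi)^-1 * ln N%:R))%:E).
  by rewrite lte_fin -mulrA ltr_pM2l// ltrDr.
apply: (@le_trans _ _ (bochner_norm 1 (bilinear_multiplier
    (fun s t : R => (chi_ge0 (s - t))%:C)
    (@shifted_tents R N (k p1 / N%:R) r z)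
    (@shifted_tents R N (k p2 / N%:R) z c)))).
  have lnN0 : 0 <= 2^-1 + (2 * pi)^-1 * ln N%:R :> R.
    by rewrite addr_ge0// mulr_ge0 ?ln_ge0 ?ler1n// invr_ge0 ltW.
  apply: bochner_norm1_ge => [|s /andP[s1 s2]]; first by rewrite mulr_ge0// ltW.
  have s0 : s != 0 by rewrite gt_eqF// (lt_le_trans ltr01).
  have ms : m <= fejer s by apply: fejer_ge; rewrite s1.
  rewrite bilinear_multiplier_tents//.
  have -> : N%:R * (k p1 / N%:R * (k p2 / N%:R)) * fejer s ^+ 2 =
      (k p1 * k p2 * fejer s ^+ 2) / N%:R.
    by field; rewrite pnatr_eq0 gtn_eqF.
  apply: le_trans (schatten_norm1_triangular N0 _
    (fun j => s * (8 * j%:R + 4)) (fun l => s * (8 * l%:R)) _).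
    rewrite kk ler_wpM2r// ler_pM2l ?invr_gt0 ?mulr_gt0//.
    by rewrite lerXn2r ?nnegrE ?fejer_ge0 ?(ltW m0).
  by rewrite kk mulr_gt0 ?invr_gt0// exprn_gt0// (lt_le_trans m0).
apply: ereal_sup_ubound.
exists (modulated_fejer N (k p1 / N%:R) r z),
  (modulated_fejer N (k p2 / N%:R) z c),
  (@shifted_tents R N (k p1 / N%:R) r z),
  (@shifted_tents R N (k p2 / N%:R) z c).
split=> //; split; try exact: in_Lp; try exact: has_fourier_modulated_fejer;
  exact: bochner_norm_modulated_fejer.
Qed.
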